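(* Let $H$ be a separable complex Hilbert space and let $A\in\mathcal{B}_2(H)$. Then $$\max\left\{\frac{1}{\sqrt2}\|A\|_2,\ \frac{\|A\|_2+|\mathrm{tr}(A^2)|^{1/2}}{2}\right\}\le w_2(A).$$
   Context: $\mathcal{B}_2(H)$ is the Hilbert–Schmidt class of compact operators $A$ on $H$ with $\|A\|_2=(\mathrm{tr}(A^*A))^{1/2}<\infty$, and $\mathrm{tr}$ is the trace. For $T\in\mathcal{B}(H)$, $Re(T)=\frac{T+T^*}{2}$, and $w_2(A)=\sup_{\theta\in\mathbb{R}}\|Re(e^{i\theta}A)\|_2$. *)

(* Defs.v *)
From HB Require Import structures.
From mathcomp Require Import all_boot all_order all_algebra.
From mathcomp Require Import complex.
From mathcomp Require Import all_classical all_reals all_analysis.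

Set Implicit Arguments.
Unset Strict Implicit.
Unset Printing Implicit Defensive.

Import Order.TTheory GRing.Theory Num.Theory.
Import numFieldNormedType.Exports.

Local Open Scope classical_set_scope.
Local Open Scope ring_scope.
Local Open Scope complex_scope.

HB.mixin Record CompleteNormedModule_isHilbert (R : realType) (H : Type)
    of CompleteNormedModule R[i] H := {
  inner : {dot H for (@Num.conj R[i])} ;
  sqr_norm_inner : forall x : H, `|x| ^+ 2 = inner x x
}.

(* The inner product is linear in its first argument and conjugate-linear in
   the second one. *)
#[short(type="hilbertType")]
HB.structure Definition Hilbert (R : realType) :=
  {H of CompleteNormedModule R[i] H & CompleteNormedModule_isHilbert R H}.

Definition separable (T : topologicalType) :=
  exists2 D : set T, countable D & dense D.

Section operators.
Context {R : realType} {H : hilbertType R}.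
Implicit Types (T : H -> H) (e : nat -> H) (t : R[i]).

Definition bounded_operator T := linear T /\ continuous T.

Definition compact_operator T := precompact (T @` [set x : H | `|x| <= 1]).

(* T^* y is the vector z, unique by definiteness of the inner product and
   given by the Riesz representation theorem when T is bounded, such that
   <T x, y> = <x, z> for all x. *)
Definition adjoint T : H -> H :=
  fun y => xget 0 [set z | forall x, inner (T x) y = inner x z].

Definition real_part T : H -> H := 2^-1 \*: (T \+ adjoint T).

(* The sequence is allowed to contain zero vectors, so that finite bases (of
   finite-dimensional spaces) are also covered: the nonzero e n form an
   orthonormal family, and it is complete. Zero vectors contribute nothing to
   the trace. *)
Definition orthonormal_basis e :=
  [/\ forall n, e n != 0 -> inner (e n) (e n) = 1,
      forall m n, m != n -> inner (e m) (e n) = 0 &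
      forall x, (forall n, inner x (e n) = 0) -> x = 0].

Definition is_trace T t :=
  forall e, orthonormal_basis e ->
    (fun n => \sum_(k < n) inner (T (e k)) (e k) : R[i]^o) @ \oo --> (t : R[i]^o).

(* When H is separable, orthonormal bases exist, hence t is unique. *)
Definition trace T : R[i] := xget 0 [set t | is_trace T t].

Definition hs_norm T : R := Num.sqrt (complex.Re (trace (adjoint T \o T))).

(* ||T||_2 < oo means that T^* T has a (finite) trace. *)
Definition hilbert_schmidt T :=
  [/\ bounded_operator T, compact_operator T &
      exists t, is_trace (adjoint T \o T) t].

Definition expi (theta : R) : R[i] := cos theta +i* sin theta.

Definition w2 T : R :=
  sup [set hs_norm (real_part (expi theta \*: T)) | theta in [set: R]].

End operators.

(* Main.v *)
From HB Require Import structures.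
Require Import Defs.
From mathcomp Require Import all_boot all_order all_algebra.
From mathcomp Require Import complex.
From mathcomp Require Import all_classical all_reals all_analysis.
From mathcomp Require Import ring lra.

(* For |u| = 1, self-adjointness of Re(uA) gives
   ||Re(uA)||_2^2 = (||A||_2^2 + Re(u^2 tr(A^2))) / 2,
   whose maximum over u is (||A||_2^2 + |tr(A^2)|) / 2; hence w_2(A) is the
   square root of this number, and both lower bounds follow, the second one
   from ((a + b) / 2)^2 <= (a^2 + b^2) / 2. That all the traces involved exist
   and do not depend on the basis comes from Parseval's identity and
   polarization; orthonormal bases come from the Gram-Schmidt process and
   adjoints from the Riesz representation theorem. *)

Set Implicit Arguments.
Unset Strict Implicit.
Unset Printing Implicit Defensive.

Import Order.TTheory GRing.Theory Num.Theory.
Import numFieldNormedType.Exports.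
Local Open Scope ring_scope.

(** * Complex sequences through their real and imaginary parts *)

Section complex_sequences.
Local Open Scope classical_set_scope.
Local Open Scope complex_scope.
Context {R : realType}.
Implicit Types (z : R[i]) (u : nat -> R[i]) (x : R).

(** Valued in [R], unlike [|z| ^+ 2], so that sums and limits live in a totally ordered field. *)
Definition sqmod z : R := complex.Re z ^+ 2 + complex.Im z ^+ 2.

Lemma sqmodE z : (sqmod z)%:C = `|z| ^+ 2.
Proof. exact: add_Re2_Im2. Qed.

Lemma sqmod_ge0 z : 0 <= sqmod z.
Proof. by rewrite addr_ge0// sqr_ge0. Qed.

(** Comparable elements of [R[i]] share their imaginary part; this turns complex radii into real
    ones. *)
Lemma gt0_complex z : 0 < z -> exists2 x, 0 < x & z = x%:C.
Proof.
case: z => a b; rewrite ltcE/= => /andP[/eqP -> a0].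
by exists a.
Qed.

Lemma normc_le_ReIm z : `|z| <= (`|complex.Re z| + `|complex.Im z|)%:C.
Proof.
rewrite {1}(complexE z) (le_trans (ler_normD _ _))// rmorphD/= normrM.
rewrite !normc_def/= expr0n/= !addr0 !sqrtr_sqr add0r expr1n sqrtr1 mul1r.
exact: lexx.
Qed.

Lemma cvg_complexP u z :
  ((u : nat -> R[i]^o) @ \oo --> (z : R[i]^o)) <->
  ((fun n => complex.Re (u n)) @ \oo --> complex.Re z /\
   (fun n => complex.Im (u n)) @ \oo --> complex.Im z).
Proof.
split => [uz|[uz1 uz2]].
- split; apply/cvgrPdist_lt => e e0.
  + have e0' : 0 < e%:C :> R[i] by rewrite ltcR.
    move/cvgrPdist_lt : uz => /(_ _ e0'); apply: filterS => n.
    move/(le_lt_trans (normc_ge_Re _)); rewrite ltcR; congr (`|_| < _).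
    by rewrite raddfB.
  + have e0' : 0 < e%:C :> R[i] by rewrite ltcR.
    move/cvgrPdist_lt : uz => /(_ _ e0'); apply: filterS => n.
    (* Multiplying by ['i] keeps the modulus and moves the imaginary part, up to sign, into the real
       part. *)
    rewrite -(normrN (_ - _)) -(mul1r (`|_|)).
    have -> : 1 = `|'i%C : R[i]|.
      by rewrite normc_def/= expr0n/= add0r expr1n sqrtr1.
    rewrite mulrC -normrM => /(le_lt_trans (normc_ge_Re _)); rewrite ltcR.
    by rewrite ReiNIm raddfN opprK raddfB.
- apply/cvgrPdist_lt => _ /gt0_complex[e e0 ->].
  have e20 : 0 < e / 2 by rewrite divr_gt0.
  move/cvgrPdist_lt : uz1 => /(_ _ e20) H1.
  move/cvgrPdist_lt : uz2 => /(_ _ e20) H2.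
  near=> n; apply: le_lt_trans (normc_le_ReIm _) _.
  rewrite ltcR (splitr e) ltrD//.
  + by rewrite raddfB; near: n.
  + by rewrite raddfB; near: n.
Unshelve. all: by end_near. Qed.

End complex_sequences.

(** * Inner product, orthonormal systems and Parseval's identity *)

Section hilbert.
Local Open Scope classical_set_scope.
Local Open Scope complex_scope.
Context {R : realType} {H : hilbertType R}.
Implicit Types (x y z : H) (a b : R[i]) (e : nat -> H).

Lemma innerDl x y z : inner (x + y) z = inner x z + inner y z.
Proof. exact: linearDl. Qed.
Lemma innerBl x y z : inner (x - y) z = inner x z - inner y z.
Proof. exact: linearBl. Qed.
Lemma innerZl a x z : inner (a *: x) z = a * inner x z.
Proof. exact: linearZl_LR. Qed.
Lemma inner0l z : inner 0 z = 0 :> R[i].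
Proof. exact: linear0l. Qed.
Lemma innerC x y : inner x y = (inner y x)^*%C.
Proof. by rewrite hermitian_subproof/= expr0 mul1r. Qed.
Lemma innerDr x y z : inner x (y + z) = inner x y + inner x z.
Proof. by rewrite innerC innerDl rmorphD/= -!innerC. Qed.
Lemma innerBr x y z : inner x (y - z) = inner x y - inner x z.
Proof. by rewrite innerC innerBl rmorphB/= -!innerC. Qed.
Lemma innerZr a x z : inner x (a *: z) = a^*%C * inner x z.
Proof. by rewrite innerC innerZl rmorphM/= -!innerC. Qed.
Lemma inner0r z : inner z 0 = 0 :> R[i].
Proof. by rewrite innerC inner0l rmorph0. Qed.

Lemma inner_suml (I : Type) (r : seq I) (F : I -> H) y :
  inner (\sum_(i <- r) F i) y = \sum_(i <- r) inner (F i) y.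
Proof. by elim/big_rec2: _ => [|i ? ? _ <-]; rewrite ?inner0l ?innerDl. Qed.

Definition sqnorm x : R := complex.Re (inner x x).

Lemma sqnormE x : (sqnorm x)%:C = inner x x.
Proof. by rewrite /sqnorm RRe_real// -sqr_norm_inner realX// normr_real. Qed.

Lemma sqnorm_normE x : (sqnorm x)%:C = `|x| ^+ 2.
Proof. by rewrite sqnormE sqr_norm_inner. Qed.

Lemma sqnorm_ge0 x : 0 <= sqnorm x.
Proof. by rewrite -ler0c sqnorm_normE exprn_ge0. Qed.

Lemma sqnorm_eq0 x : sqnorm x = 0 -> x = 0.
Proof.
by move=> nx; apply/eqP; rewrite -normr_eq0 -sqrf_eq0 -sqnorm_normE nx.
Qed.

Lemma inner_self_eq0 x : inner x x = 0 -> x = 0.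
Proof. by move=> h; apply: sqnorm_eq0; rewrite /sqnorm h. Qed.

Lemma sqnormD x y :
  sqnorm (x + y) = sqnorm x + sqnorm y + 2 * complex.Re (inner x y).
Proof.
rewrite /sqnorm innerDl !innerDr [inner y x]innerC.
case: (inner x y) (inner x x) (inner y y) => [a b] [c d] [f g] /=.
by ring.
Qed.

Lemma sqnormZ a x : sqnorm (a *: x) = sqmod a * sqnorm x.
Proof.
apply: complexI; rewrite rmorphM/= sqmodE !sqnorm_normE normrZ exprMn//.
Qed.

Lemma sqnorm0 : sqnorm 0 = 0.
Proof. by rewrite /sqnorm inner0l. Qed.

Lemma sqnormD_ortho x y : inner x y = 0 -> sqnorm (x + y) = sqnorm x + sqnorm y.
Proof. by move=> xy; rewrite sqnormD xy/= mulr0 addr0. Qed.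

Lemma CauchySchwarz_norm x y : `|inner x y| <= `|x| * `|y|.
Proof.
have [->|y0] := eqVneq y 0; first by rewrite inner0r !normr0 mulr0.
have ny0 : 0 < sqnorm y by rewrite -ltcR sqnorm_normE exprn_gt0// normr_gt0.
set c := inner x y.
(* This vector is |y|^2 times the component of x orthogonal to y; the scaling avoids a division. *)
have : 0 <= sqnorm ((sqnorm y)%:C *: x + (- c) *: y) by exact: sqnorm_ge0.
rewrite sqnormD !sqnormZ innerZr innerZl -/c -addrA.
have -> : sqmod (sqnorm y)%:C = sqnorm y ^+ 2 by rewrite /sqmod/= expr0n/= addr0.
have -> : sqmod (- c) * sqnorm y +
    2 * complex.Re ((- c)^*%C * ((sqnorm y)%:C * c)) = - (sqnorm y * sqmod c).
  by rewrite /sqmod; case: (c) => a b /=; ring.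
move=> h; have : 0 <= sqnorm y * (sqnorm x * sqnorm y - sqmod c).
  suff -> : sqnorm y * (sqnorm x * sqnorm y - sqmod c) =
      sqnorm y ^+ 2 * sqnorm x + - (sqnorm y * sqmod c) by [].
  by ring.
rewrite pmulr_rge0// subr_ge0 -lecR sqmodE rmorphM/= !sqnorm_normE -exprMn.
by rewrite ler_pXn2r// nnegrE ?mulr_ge0.
Qed.

Lemma cvg_innerl (I : Type) (F : set_system I) {FF : Filter F}
    (s : I -> H) x y :
  s @ F --> x ->
  (fun i => inner (s i) y : R[i]^o) @ F --> (inner x y : R[i]^o).
Proof.
move=> sx; apply/cvgrPdist_lt => eps eps0.
have y0 : 0 < `|y| + 1 by rewrite ltr_wpDl.
have e0 : 0 < eps / (`|y| + 1) by rewrite divr_gt0.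
move/cvgrPdist_lt : sx => /(_ _ e0); apply: filterS => n xs.
rewrite -innerBl (le_lt_trans (CauchySchwarz_norm _ _))//.
rewrite (@le_lt_trans _ _ (`|x - s n| * (`|y| + 1)))//.
  by rewrite ler_wpM2l// lerDl.
by rewrite -ltr_pdivlMr.
Qed.

Lemma cvg_sqnorm_dist (s : nat -> H) x : s @ \oo --> x ->
  (fun n => sqnorm (x - s n)) @ \oo --> (0 : R).
Proof.
move=> sx; apply/cvgrPdist_lt => eps eps0.
have e0 : 0 < (Num.sqrt eps)%:C by rewrite ltcR sqrtr_gt0.
move/cvgrPdist_lt : sx => /(_ _ e0); apply: filterS => n xs.
rewrite sub0r normrN ger0_norm ?sqnorm_ge0// -ltcR sqnorm_normE.
by rewrite -(sqr_sqrtr (ltW eps0)) rmorphXn/= ltr_pXn2r// nnegrE// ltW.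
Qed.

(** Orthonormality without completeness; zero vectors stay allowed, as in [orthonormal_basis]. *)
Definition orthosys e := (forall n, e n != 0 -> inner (e n) (e n) = 1) /\
  (forall m n, m != n -> inner (e m) (e n) = 0).

Lemma onb_orthosys e : orthonormal_basis e -> orthosys e.
Proof. by case. Qed.

(** The factor is 1 unless [e n = 0], where both sides vanish; this absorbs zero vectors in Fourier
    sums. *)
Lemma orthosys_scale e x n : orthosys e ->
  inner x (e n) * inner (e n) (e n) = inner x (e n).
Proof.
case=> h1 _; have [->|/h1 ->] := eqVneq (e n) 0; last by rewrite mulr1.
by rewrite !inner0r mul0r.
Qed.

Lemma orthosys_sqnorm_le1 e n : orthosys e -> sqnorm (e n) <= 1.
Proof.
case=> h1 _; have [->|/h1] := eqVneq (e n) 0; first by rewrite sqnorm0.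
by rewrite /sqnorm => ->.
Qed.

(** Pythagoras, weakened to an inequality because a zero [e k] removes [c k] from the left-hand side
    only. *)
Lemma sqnorm_orthosum_le e (c : nat -> R[i]) m n : orthosys e ->
  sqnorm (\sum_(m <= k < n) c k *: e k) <= \sum_(m <= k < n) sqmod (c k).
Proof.
move=> os; have [_ o] := os.
elim: n => [|n IH]; first by rewrite !big_geq// sqnorm0.
have [mn|nm] := leqP m n; last by rewrite !big_geq// sqnorm0.
rewrite !big_nat_recr//= sqnormD_ortho; last first.
  rewrite inner_suml big_seq big1// => k; rewrite mem_index_iota => /andP[_ kn].
  by rewrite innerZl innerZr o ?mulr0// neq_ltn kn.
rewrite lerD// sqnormZ -[leRHS]mulr1 ler_wpM2l ?sqmod_ge0//.
exact: orthosys_sqnorm_le1.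
Qed.

(** Blocks of the series are dominated by blocks of the convergent real series of [sqmod (c k)], so
    the Cauchy criterion applies in the complete space [H]. *)
Lemma orthoseries_cvg e (c : nat -> R[i]) (B : R) : orthosys e ->
  (forall N, \sum_(0 <= k < N) sqmod (c k) <= B) ->
  cvgn (series (fun k => c k *: e k)).
Proof.
move=> os cB; apply/cauchy_cvgP/cauchy_seriesP => _ /gt0_complex[eps eps0 ->].
have /cauchy_cvgP/cauchy_seriesP : cvgn (series (fun k => sqmod (c k))).
  apply: nondecreasing_is_cvgn.
    by apply/nondecreasing_seqP => n; rewrite /series/= big_nat_recr//= lerDl sqmod_ge0.
  by exists B => _ [n _ <-]; exact: cB.
move=> /(_ (eps ^+ 2)); rewrite exprn_gt0// => /(_ isT); apply: filterS => -[m n]/=.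
rewrite ger0_norm; last by apply: sumr_ge0 => k _; exact: sqmod_ge0.
move=> /(le_lt_trans (sqnorm_orthosum_le _ _ _ os)).
rewrite -ltcR sqnorm_normE rmorphXn/=.
by rewrite ltr_pXn2r// nnegrE// ler0c ltW.
Qed.

Definition fproj e N x := \sum_(0 <= k < N) inner x (e k) *: e k.

Lemma inner_orthosum e (c : nat -> R[i]) N k : orthosys e -> (k < N)%N ->
  inner (\sum_(0 <= j < N) c j *: e j) (e k) = c k * inner (e k) (e k).
Proof.
move=> [_ o] kN; rewrite inner_suml (bigD1_seq k)//= ?mem_index_iota ?iota_uniq//.
rewrite innerZl big1 ?addr0// => j jk.
by rewrite innerZl o ?mulr0.
Qed.

Lemma sqnorm_fproj e N x : orthosys e ->
  sqnorm (x - fproj e N x) = sqnorm x - \sum_(0 <= k < N) sqmod (inner x (e k)).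
Proof.
move=> os; have [_ o] := os.
elim: N => [|N IH]; first by rewrite /fproj !big_geq// !subr0.
rewrite /fproj !big_nat_recr//= -/(fproj _ _ _) opprD addrA.
rewrite opprD addrA -IH.
set c := inner x (e N); set w := x - _.
(* The terms already removed are orthogonal to [e N], so the remainder keeps the coefficient of [x]
   along it. *)
have wN : inner w (e N) = c.
  rewrite /w innerBl /fproj inner_suml big_seq big1 ?subr0// => k.
  rewrite mem_index_iota => /andP[_ kN].
  by rewrite innerZl o ?mulr0// neq_ltn kN.
have -> : w - c *: e N = w + (- c) *: e N by rewrite scaleNr.
rewrite sqnormD sqnormZ innerZr wN.
have cc := orthosys_scale x N os.
have : sqmod c * sqnorm (e N) = sqmod c.
  by apply: complexI; rewrite rmorphM/= sqmodE sqnormE sqr_normc mulrAC cc.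
rewrite {1 2}/sqmod; case: (c) => a b /=; rewrite /sqmod/= => h.
have -> : ((- a) ^+ 2 + (- b) ^+ 2) * sqnorm (e N) = a ^+ 2 + b ^+ 2 by rewrite !sqrrN.
by ring.
Qed.

Lemma bessel e N x : orthosys e ->
  \sum_(0 <= k < N) sqmod (inner x (e k)) <= sqnorm x.
Proof. by move=> os; rewrite -subr_ge0 -sqnorm_fproj// sqnorm_ge0. Qed.

(** Bessel makes the Fourier series converge to some [z]; [x - z] is orthogonal to every [e k], so
    completeness gives [x = z]. *)
Lemma cvg_fproj e x : orthonormal_basis e ->
  (fun N => fproj e N x) @ \oo --> x.
Proof.
move=> onb; have os := onb_orthosys onb; have [_ _ comp] := onb.
have /cvg_ex[/= z hz] := orthoseries_cvg os (fun N => bessel N x os).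
suff xz : x = z by rewrite {2}xz; exact: hz.
apply/eqP; rewrite -subr_eq0; apply/eqP/comp => k; rewrite innerBl.
apply/eqP; rewrite subr_eq0; apply/eqP.
apply: (cvg_unique (@norm_hausdorff _ R[i]^o) _ (cvg_innerl hz)).
apply: cvg_near_cst; near=> n.
rewrite /series/= inner_orthosum ?orthosys_scale//.
by near: n; exists k.+1.
Unshelve. all: by end_near. Qed.

Lemma parseval e x : orthonormal_basis e ->
  (fun N => \sum_(0 <= k < N) sqmod (inner x (e k))) @ \oo --> sqnorm x.
Proof.
move=> onb; have os := onb_orthosys onb.
have : (fun N => sqnorm x - sqnorm (x - fproj e N x)) @ \oo --> sqnorm x - 0.
  by apply: cvgB; [exact: cvg_cst|exact/cvg_sqnorm_dist/cvg_fproj].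
rewrite subr0; apply: cvg_trans; apply: near_eq_cvg; near=> n.
by rewrite sqnorm_fproj// opprB addrC subrK.
Unshelve. all: by end_near. Qed.

End hilbert.

(** * The Gram-Schmidt process and orthonormal bases *)

Section gram_schmidt.
Local Open Scope classical_set_scope.
Local Open Scope complex_scope.
Context {R : realType} {H : hilbertType R}.
Implicit Types (x y z : H) (e d : nat -> H).

Definition normalize x : H := `|x|^-1 *: x.

Lemma normalizeK x : `|x| *: normalize x = x.
Proof.
have [->|x0] := eqVneq x 0; first by rewrite normr0 scale0r.
by rewrite /normalize scalerA divff ?normr_eq0// scale1r.
Qed.

Lemma inner_normalize x : normalize x != 0 ->
  inner (normalize x) (normalize x) = 1.
Proof.
move=> nx0; have x0 : x != 0.
  by apply: contra_neq nx0 => ->; rewrite /normalize scaler0.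
rewrite -sqr_norm_inner /normalize normrZ normfV normr_id mulVf ?expr1n//.
by rewrite normr_eq0.
Qed.

(* Since |0|^-1 = 0, a vector [d m] depending on its predecessors yields a zero
   vector, which an [orthonormal_basis] may contain. *)
Fixpoint gs_proj d n : H -> H :=
  if n is m.+1 then
    let v := normalize (d m - gs_proj d m (d m)) in
    fun x => gs_proj d m x + inner x v *: v
  else fun=> 0.

Definition gram_schmidt d n := normalize (d n - gs_proj d n (d n)).

Lemma gs_projE d n x : gs_proj d n x = fproj (gram_schmidt d) n x.
Proof.
elim: n => [|n IH]; first by rewrite /fproj big_geq.
by rewrite /= /fproj big_nat_recr//= IH.
Qed.

(** By strong induction only the k-th term of the projection meets [e k], and it cancels
    [inner (d n) (e k)]. *)
Lemma inner_gram_schmidt_lt d n k : (k < n)%N ->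
  inner (gram_schmidt d n) (gram_schmidt d k) = 0.
Proof.
set e := gram_schmidt d; elim/ltn_ind: n k => n IH k kn.
rewrite {1}/e /gram_schmidt /normalize innerZl gs_projE -/e.
suff -> : inner (d n - fproj e n (d n)) (e k) = 0 by rewrite mulr0.
rewrite innerBl /fproj inner_suml (bigD1_seq k)//= ?mem_index_iota ?iota_uniq//.
rewrite [X in _ - (_ + X)]big_seq_cond big1 ?addr0; last first.
  move=> j /andP[]; rewrite mem_index_iota => /andP[_ jn] jk.
    rewrite innerZl; idtac; have [kj|jk'|/eqP] := ltngtP k j.
  - by rewrite IH// mulr0.
  - by rewrite [inner (e j) _]innerC IH// conjc0 mulr0.
  - by rewrite eq_sym (negbTE jk).
rewrite innerZl.
have [->|ek0] := eqVneq (e k) 0; first by rewrite !inner0r mulr0 subrr.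
by rewrite inner_normalize// mulr1 subrr.
Qed.

Lemma gram_schmidt_orthosys d : orthosys (gram_schmidt d).
Proof.
split=> [n|m n]; first exact: inner_normalize.
rewrite neq_ltn => /orP[mn|nm]; last exact: inner_gram_schmidt_lt.
by rewrite innerC inner_gram_schmidt_lt// conjc0.
Qed.

(** Each [d n] is a combination of the first n + 1 Gram-Schmidt vectors. *)
Lemma gram_schmidt_span d x : (forall n, inner x (gram_schmidt d n) = 0) ->
  forall n, inner x (d n) = 0.
Proof.
move=> h n; rewrite -(subrK (gs_proj d n (d n)) (d n)) innerDr.
rewrite -[in X in X + _](normalizeK (d n - _)) innerZr.
rewrite -/(gram_schmidt d n) h mulr0 add0r.
rewrite gs_projE /fproj innerC inner_suml big1 ?conjc0// => k _.
by rewrite innerZl [inner _ x]innerC h conjc0 mulr0.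
Qed.

(** A nonzero x orthogonal to the Gram-Schmidt vectors of a dense sequence would be orthogonal to
    the dense set, hence at distance at least |x| from it. *)
Lemma separable_onb : separable H -> exists e, orthonormal_basis (e : nat -> H).
Proof.
case=> D /countable_injP[f finj] denseD.
(* [d] enumerates [D] by inverting [f]; indices that [f] does not reach from [D] get the harmless
   value 0. *)
pose d n := xget 0 [set x | D x /\ f x = n].
have dE x : D x -> d (f x) = x.
  move=> Dx; apply: xget_unique => // y [Dy fy].
  by apply: finj => //; rewrite inE.
have [h1 h2] := gram_schmidt_orthosys d.
exists (gram_schmidt d); split => // x hx; apply: contrapT => /eqP x0.
have nx0 : 0 < `|x| by rewrite normr_gt0.
have [y [xy Dy]] : ball x `|x| `&` D !=set0.
  apply: denseD; last exact: ball_open.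
  by exists x; exact: ballxx.
move: xy; rewrite -ball_normE/= -(@ltr_pXn2r _ 2)// ?nnegrE// -!sqnorm_normE ltcR.
have xy0 : inner x (- y) = 0.
  by rewrite -[y]dE// -scaleN1r innerZr gram_schmidt_span// mulr0.
by rewrite sqnormD_ortho// ltNge lerDl sqnorm_ge0.
Qed.

End gram_schmidt.

(** * Riesz representation and adjoints *)

Section adjoint.
Local Open Scope classical_set_scope.
Local Open Scope complex_scope.
Context {R : realType} {H : hilbertType R}.
Implicit Types (x y z : H) (T S : H -> H).

(** The representing vector is the sum of conj (f (e k)) e k. Agreement on each [e k] extends to
    Fourier sums by linearity and to all x by continuity. *)
Lemma riesz (e : nat -> H) (f : {linear H -> R[i]^o}) :
  orthonormal_basis e -> continuous f -> exists z, forall x, f x = inner x z.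
Proof.
move=> onb cf; have os := onb_orthosys onb.
have [K K0 fK] : exists2 K : R, 0 < K & forall x, `|f x| <= K%:C * `|x|.
  have /linear_bounded_continuous/linear_boundedP fb := cf.
  have [r r0 fr] : exists2 r : R[i], 0 < r & forall x, `|f x| <= r * `|x|.
    near (+oo : set_system R[i]) => r; exists r; first by [].
    by near: r.
  by have [K K0 rK] := gt0_complex r0; exists K => // x; rewrite -rK.
pose c k : R[i] := (f (e k))^*%C.
pose s N := \sum_(0 <= k < N) c k *: e k.
have fs N : f (s N) = (\sum_(0 <= k < N) sqmod (c k))%:C.
  rewrite linear_sum rmorph_sum/=; apply: eq_bigr => k _.
  by rewrite linearZ/= sqmodE sqr_normc /c conjcK.
(* For t = f (s N), t <= K |s N| and |s N|^2 <= t give t^2 <= K^2 t, a bound on t uniform in N. *)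
have sK N : \sum_(0 <= k < N) sqmod (c k) <= K ^+ 2.
  set t := (leLHS); have t0 : 0 <= t by apply: sumr_ge0 => k _; exact: sqmod_ge0.
  have : t ^+ 2 <= K ^+ 2 * t.
    rewrite (@le_trans _ _ (K ^+ 2 * sqnorm (s N)))//; last first.
      by rewrite ler_wpM2l ?sqr_ge0// sqnorm_orthosum_le.
    rewrite -lecR (rmorphM _ (K ^+ 2)) rmorphXn/= sqnorm_normE rmorphXn/= -exprMn.
    rewrite ler_pXn2r ?nnegrE ?ler0c//.
      by rewrite (le_trans _ (fK (s N)))// fs normc_def/= expr0n addr0
        sqrtr_sqr ger0_norm.
    by rewrite mulr_ge0// ler0c ltW.
  rewrite expr2; have [->|tn0] := eqVneq t 0; first by rewrite sqr_ge0.
  by rewrite ler_pM2r// lt_neqAle eq_sym tn0.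
have /cvg_ex[/= z hz] := orthoseries_cvg os sK.
have ez k : f (e k) = inner (e k) z.
  rewrite innerC; apply: (can_inj (@conjcK R)); rewrite conjcK.
  apply: (cvg_unique (@norm_hausdorff _ R[i]^o) _ (cvg_innerl hz)).
  apply: cvg_near_cst; near=> n.
  rewrite /series/= inner_orthosum//; last by near: n; exists k.+1.
  rewrite /c; have [->|ek0] := eqVneq (e k) 0.
    by rewrite inner0r linear0 mulr0 conjc0.
  by case: os => -> //; rewrite mulr1.
exists z => x.
have h1 : (fun N => f (fproj e N x)) @ \oo --> f x.
  by apply: continuous_cvg; [exact: cf|exact: cvg_fproj].
apply: (cvg_unique (@norm_hausdorff _ R[i]^o) h1).
have -> : (fun N => f (fproj e N x)) = (fun N => inner (fproj e N x) z).
  apply/funext => N; rewrite /fproj linear_sum inner_suml.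
  by apply: eq_bigr => k _; rewrite linearZ innerZl/= ez.
by apply: cvg_innerl; exact: cvg_fproj.
Unshelve. all: by end_near. Qed.

(** A relation can be checked directly on explicit candidates; [adjointE] then identifies the chosen
    [adjoint]. *)
Definition adj T S := forall x y, inner (T x) y = inner x (S y).

Lemma adj_sym T S : adj T S -> adj S T.
Proof. by move=> h x y; rewrite innerC -h -innerC. Qed.

Lemma adjointE T S : adj T S -> adjoint T = S.
Proof.
move=> h; apply/funext => y; apply: xget_unique => [x|z hz]; first exact: h.
apply/eqP; rewrite -subr_eq0; apply/eqP/inner_self_eq0.
by rewrite innerBr -hz h subrr.
Qed.

Lemma adjointP T : separable H -> bounded_operator T -> adj T (adjoint T).
Proof.
move=> /separable_onb[e onb] [linT cT] x y.
suff [z hz] : exists z, forall x, inner (T x) y = inner x z.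
  by apply: (@xgetPex _ 0 [set z | forall x, inner (T x) y = inner x z]); exists z.
have flin : linear (fun x => inner (T x) y : R[i]^o).
  by move=> a u v; rewrite linT innerDl innerZl.
pose f : {linear H -> R[i]^o} :=
  HB.pack (fun x => inner (T x) y : R[i]^o) (GRing.isLinear.Build _ _ _ _ _ flin).
by apply: (@riesz e f onb) => u; apply: cvg_innerl; exact: cT.
Qed.

End adjoint.

(** * Hilbert-Schmidt sums, traces and independence of the basis *)

Section hilbert_schmidt_sums.
Local Open Scope classical_set_scope.
Local Open Scope complex_scope.
Context {R : realType} {H : hilbertType R}.
Implicit Types (x y z : H) (T S : H -> H) (e f : nat -> H) (B c : R).

Definition hs_sum T e N : R := \sum_(0 <= k < N) sqnorm (T (e k)).

Lemma hs_sum_nondecreasing T e : nondecreasing_seq (hs_sum T e).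
Proof.
by apply/nondecreasing_seqP => n; rewrite /hs_sum big_nat_recr//= lerDl sqnorm_ge0.
Qed.

(* Parseval along [f] expands the left-hand side into a double sum; after
   exchanging the sums, Bessel along [e] bounds it by the sums of [S]. *)
Lemma hs_sum_adj_le T S e f B : orthonormal_basis e -> orthonormal_basis f ->
  adj T S -> (forall M, hs_sum S f M <= B) -> forall N, hs_sum T e N <= B.
Proof.
move=> onbe onbf TS SB N; have ose := onb_orthosys onbe.
have h : (fun M => \sum_(0 <= k < N) \sum_(0 <= m < M)
      sqmod (inner (T (e k)) (f m)))
    @ \oo --> hs_sum T e N.
  by apply: cvg_big => [|k _]; [exact: add_continuous|exact: parseval].
apply: (cvgr_to_le h) => //; near=> M.
rewrite exchange_big/= (le_trans _ (SB M))//; apply: ler_sum => m _.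
rewrite (le_trans _ (bessel N (S (f m)) ose))//; apply: ler_sum => k _.
by rewrite TS innerC /sqmod; case: (inner _ _) => a b /=; rewrite sqrrN.
Unshelve. all: by end_near. Qed.

(** Expresses ||T||_2^2 = c, with finiteness and independence of the basis built in. *)
Definition hs_sqr T c :=
  forall e, orthonormal_basis e -> hs_sum T e @ \oo --> c.

Lemma hs_sum_le T e c : hs_sum T e @ \oo --> c -> forall N, hs_sum T e N <= c.
Proof.
move=> Tc N; rewrite -(cvg_lim (@Rhausdorff R) Tc).
apply: nondecreasing_cvgn_le; first exact: hs_sum_nondecreasing.
by apply/cvg_ex; exists c.
Qed.

(** [hs_sum_adj_le], used in both directions, compares the two limits; one basis for T thus controls
    every basis for S. *)
Lemma hs_sqr_adj T S e c : orthonormal_basis e -> adj T S ->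
  hs_sum T e @ \oo --> c -> hs_sqr S c.
Proof.
move=> onbe TS Tc f onbf.
have Sc := hs_sum_adj_le onbf onbe (adj_sym TS) (hs_sum_le Tc).
have : cvgn (hs_sum S f).
  apply: nondecreasing_is_cvgn; first exact: hs_sum_nondecreasing.
  by exists c => _ [N _ <-].
move=> /cvg_ex[/= d Sd]; suff <- : d = c by [].
apply/eqP; rewrite eq_le; apply/andP; split.
  by apply: (cvgr_to_le Sd); near=> N.
by apply: (cvgr_to_le Tc); near=> N;
  exact: (hs_sum_adj_le onbe onbf TS (hs_sum_le Sd)).
Unshelve. all: by end_near. Qed.

Lemma hs_sqr_exists T S e B : orthonormal_basis e -> adj T S ->
  (forall N, hs_sum T e N <= B) -> exists c, hs_sqr T c.
Proof.
move=> onbe TS TB.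
have : cvgn (hs_sum T e).
  apply: nondecreasing_is_cvgn; first exact: hs_sum_nondecreasing.
  by exists B => _ [N _ <-].
move=> /cvg_ex[/= c Tc]; exists c.
(* Passing to [S] and back to [T] replaces the given basis by an arbitrary one. *)
have Sc := hs_sqr_adj onbe TS Tc.
exact: (hs_sqr_adj onbe (adj_sym TS) (Sc _ onbe)).
Qed.

(** A basis rules out the vacuous case in which every number satisfies [is_trace T]. *)
Lemma traceE T t e : orthonormal_basis e -> is_trace T t -> trace T = t.
Proof.
move=> onbe Tt; apply: xget_unique => // s Ts.
exact: (cvg_unique (@norm_hausdorff _ R[i]^o) (Ts e onbe) (Tt e onbe)).
Qed.

Lemma hs_sqr_is_trace T S t : adj T S ->
  is_trace (S \o T) t -> hs_sqr T (complex.Re t).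
Proof.
move=> TS tr e onbe; have /cvg_complexP[+ _] := tr e onbe.
apply: cvg_trans; apply: near_eq_cvg; near=> N.
rewrite raddf_sum /hs_sum big_mkord; apply: eq_bigr => k _ /=.
by rewrite innerC -TS -sqnormE.
Unshelve. all: by end_near. Qed.

Lemma is_trace_hs_sqr T S c : adj T S -> hs_sqr T c -> is_trace (S \o T) c%:C.
Proof.
move=> TS Tc e onbe.
have -> : (fun n => \sum_(k < n) inner ((S \o T) (e k)) (e k)) =
    (fun n => (hs_sum T e n)%:C).
  apply/funext => n; rewrite /hs_sum big_mkord rmorph_sum/=.
  by apply: eq_bigr => k _; rewrite innerC -TS -sqnormE conjc_real.
by apply/cvg_complexP; split; [exact: Tc|exact: cvg_cst].
Qed.

Lemma hs_normE T S c e : orthonormal_basis e -> adj T S -> hs_sqr T c ->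
  hs_norm T = Num.sqrt c.
Proof.
move=> onbe TS Tc; rewrite /hs_norm (adjointE TS).
by rewrite (traceE onbe (is_trace_hs_sqr TS Tc)).
Qed.

Lemma adj_comb T S (a : R[i]) : adj T S ->
  adj (fun x => T x + a *: S x) (fun x => S x + a^*%C *: T x).
Proof.
move=> TS x y /=. rewrite innerDl innerDr innerZl innerZr. rewrite conjcK TS.
by rewrite (adj_sym TS).
Qed.

(** The parallelogram law with the nonnegative term [sqnorm (x - y)] dropped. *)
Lemma sqnormD_le x y : sqnorm (x + y) <= 2 * (sqnorm x + sqnorm y).
Proof.
have : 0 <= sqnorm (x - y) by exact: sqnorm_ge0.
rewrite sqnormD -scaleN1r sqnormZ innerZr sqnormD /sqmod.
case: (inner x y) => a b /=; nra.
Qed.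

(* Polarization: the trace of [T \o T] is a combination of the squared norms of
   [T], [T + S] and [T + 'i S], where [S] is the adjoint of [T]. *)
Lemma is_trace_sqr T S c e : orthonormal_basis e -> adj T S -> hs_sqr T c ->
  exists t, is_trace (T \o T) t.
Proof.
move=> onbe TS Tc.
have Sc := hs_sqr_adj onbe TS (Tc _ onbe).
have hs_comb (a : R[i]) : exists d, hs_sqr (fun x => T x + a *: S x) d.
  apply: (@hs_sqr_exists _ _ e (2 * (c + sqmod a * c)) onbe (adj_comb a TS)) => N.
  rewrite (@le_trans _ _ (2 * (hs_sum T e N + sqmod a * hs_sum S e N)))//.
    rewrite /hs_sum mulr_sumr -big_split mulr_sumr/=; apply: ler_sum => k _.
    by rewrite -sqnormZ sqnormD_le.
  by rewrite ler_wpM2l// lerD ?ler_wpM2l ?sqmod_ge0// hs_sum_le//;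
    [exact: Tc|exact: Sc].
have Re_cvg (a : R[i]) : exists d : R, forall f, orthonormal_basis f ->
    (fun N => \sum_(0 <= k < N) complex.Re (a^*%C * inner (T (f k)) (S (f k))))
      @ \oo --> d.
  have [d hd] := hs_comb a; exists ((d - c - sqmod a * c) / 2) => f onbf.
  have -> : (fun N => \sum_(0 <= k < N)
        complex.Re (a^*%C * inner (T (f k)) (S (f k)))) =
      (fun N => (hs_sum (fun x => T x + a *: S x) f N - hs_sum T f N
        - sqmod a * hs_sum S f N) / 2).
    apply/funext => N; rewrite /hs_sum mulr_sumr -!sumrB mulr_suml.
    by apply: eq_bigr => k _; rewrite sqnormD sqnormZ innerZr; field.
  apply: cvgMl; apply: cvgB; first by apply: cvgB; [exact: hd|exact: Tc].
  by apply: cvgMr; exact: Sc.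
(* Since <T (T x), x> = <T x, S x>, the choices a = 1 and a = i give the real and imaginary parts of
   the trace. *)
have [d1 h1] := Re_cvg 1; have [d2 h2] := Re_cvg 'i%C.
exists (d1 +i* d2) => f onbf; apply/cvg_complexP; split => /=.
  apply: cvg_trans (h1 f onbf); apply: near_eq_cvg; near=> N.
  rewrite raddf_sum big_mkord; apply: eq_bigr => k _ /=.
  by rewrite [inner (T (T _)) _]TS; case: (inner _ _) => a b /=; ring.
apply: cvg_trans (h2 f onbf); apply: near_eq_cvg; near=> N.
rewrite raddf_sum big_mkord; apply: eq_bigr => k _ /=.
by rewrite [inner (T (T _)) _]TS; case: (inner _ _) => a b /=; ring.
Unshelve. all: by end_near. Qed.

Lemma real_part_phase T S (u : R[i]) : adj T S -> sqmod u = 1 ->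
  real_part (u \*: T) = fun x => 2^-1 *: (u *: T x + u^*%C *: S x).
Proof.
move=> TS u1; rewrite /real_part (@adjointE _ _ _ (u^*%C \*: S))// => x y /=.
by rewrite innerZl innerZr conjcK TS.
Qed.

Lemma real_part_self_adj T S (u : R[i]) : adj T S -> sqmod u = 1 ->
  adj (real_part (u \*: T)) (real_part (u \*: T)).
Proof.
move=> TS u1; rewrite (real_part_phase TS u1) => x y.
rewrite innerZl innerZr innerDl innerDr !innerZl !innerZr conjcK TS (adj_sym TS).
by rewrite conjc_inv conjc_nat [_ + u * _]addrC.
Qed.

(** Expanding |u T x + conj u S x|^2 / 4 gives the cross term 2 Re (u^2 <T x, S x>) / 4, where <T x,
    S x> = <T (T x), x>; [T] and [S] each contribute c / 4. *)
Lemma hs_sqr_real_part T S (u : R[i]) c t e : orthonormal_basis e ->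
  adj T S -> hs_sqr T c -> is_trace (T \o T) t -> sqmod u = 1 ->
  hs_sqr (real_part (u \*: T)) ((c + complex.Re (u ^+ 2 * t)) / 2).
Proof.
move=> onbe TS Tc Tt u1 f onbf; have Sc := hs_sqr_adj onbe TS (Tc _ onbe).
have -> : hs_sum (real_part (u \*: T)) f =
    (fun N => (hs_sum T f N + hs_sum S f N + 2 * complex.Re (u ^+ 2 *
       \sum_(k < N) inner ((T \o T) (f k)) (f k))) / 4).
  apply/funext => N; rewrite (real_part_phase TS u1) /hs_sum !big_mkord.
  rewrite mulr_sumr raddf_sum mulr_sumr -!big_split mulr_suml/=.
  apply: eq_bigr => k _.
  rewrite sqnormZ sqnormD !sqnormZ innerZl innerZr conjcK u1.
  have -> : sqmod u^*%C = 1 by rewrite -u1 /sqmod; case: (u) => a b /=; rewrite sqrrN.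
  have -> : sqmod (2^-1 : R[i]) = 4^-1.
    apply: complexI; rewrite sqmodE normfV ger0_norm// fmorphV/= rmorph_nat.
    by rewrite exprVn -natrX.
  by rewrite [inner (T (T _)) _]TS mulrA -expr2; field.
have -> : (c + complex.Re (u ^+ 2 * t)) / 2 =
    (c + c + 2 * complex.Re (u ^+ 2 * t)) / 4 by field.
apply: cvgMl; apply: cvgD; first by apply: cvgD; [exact: Tc|exact: Sc].
apply: cvgMr.
have /cvg_complexP[t1 t2] := Tt f onbf.
have ReM (z w : R[i]) : complex.Re (z * w) =
  complex.Re z * complex.Re w - complex.Im z * complex.Im w
    by case: z w => ? ? [].
rewrite ReM; under eq_fun do rewrite ReM.
by apply: cvgB; apply: cvgMr.
Qed.

End hilbert_schmidt_sums.

(** * Choice of the optimal phase *)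

Section phase.
Local Open Scope classical_set_scope.
Local Open Scope complex_scope.
Context {R : realType}.
Implicit Types (z : R[i]) (theta : R).

Lemma sqmod_expi theta : sqmod (expi theta) = 1.
Proof. by rewrite /sqmod/= cos2Dsin2. Qed.

Lemma expi_sqr theta : expi theta ^+ 2 = expi (theta + theta).
Proof.
rewrite expr2 /expi cosD sinD; simpc.
by congr (_ +i* _); rewrite addrC.
Qed.

Lemma Re_phase_le z theta :
  complex.Re (expi theta ^+ 2 * z) <= complex.Re `|z|.
Proof.
have : `|complex.Re (expi theta ^+ 2 * z)|%:C <= `|z|.
  rewrite (le_trans (normc_ge_Re _))// normrM normrX.
  by rewrite -sqmodE sqmod_expi mul1r.
rewrite lecE/= => /andP[_]; apply: le_trans; exact: ler_norm.
Qed.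

(** For nonzero z, theta is half an argument phi of conj z, so that the squared phase rotates z onto
    |z|. *)
Lemma phase_exists z :
  exists theta, complex.Re (expi theta ^+ 2 * z) = complex.Re `|z|.
Proof.
have [->|z0] := eqVneq z 0; first by exists 0; rewrite mulr0 normr0.
case: z z0 => a b z0; set r := complex.Re `|a +i* b|.
have rE : r ^+ 2 = a ^+ 2 + b ^+ 2.
  by rewrite /r normc_def/= sqr_sqrtr// addr_ge0// sqr_ge0.
have r0 : 0 < r by rewrite -ltcR /r RRe_real ?normr_real// normr_gt0.
have rn0 : r != 0 by rewrite gt_eqF.
have ar : -1 <= a / r <= 1.
  rewrite -ler_norml -(@ler_pXn2r _ 2)// ?nnegrE// expr1n real_normK ?num_real//.
  by rewrite expr_div_n ler_pdivrMr ?exprn_gt0// mul1r rE lerDl sqr_ge0.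
have sn : sin (acos (a / r)) = `|b| / r.
  rewrite sin_acos// -[RHS]ger0_norm ?divr_ge0 ?(ltW r0)// -sqrtr_sqr.
  congr Num.sqrt; rewrite !expr_div_n real_normK ?num_real// rE.
  by field; rewrite -rE expf_neq0.
have [phi cphi sphi] : exists2 phi, cos phi = a / r & sin phi = - (b / r).
  (* [acos] only yields angles with nonnegative sine, so the sign of b decides the sign of phi. *)
  have [b0|b0] := leP 0 b.
    exists (- acos (a / r)); first by rewrite cosN acosK.
    by rewrite sinN sn ger0_norm.
  exists (acos (a / r)); first by rewrite acosK.
  by rewrite sn ltr0_norm// mulNr.
exists (phi / 2); rewrite expi_sqr -splitr /expi cphi sphi/=.
by apply: (mulfI rn0); rewrite -expr2 rE; field.
Qed.

End phase.

(** * Lower bounds for w_2 *)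

Theorem theorem5p1 (R : realType) (H : hilbertType R)
    (sepH : separable H) (A : H -> H) (HA : hilbert_schmidt A) :
  Num.max ((Num.sqrt 2)^-1 * hs_norm A)
          ((hs_norm A + Num.sqrt (complex.Re `|trace (A \o A)|)) / 2)
    <= w2 A.
Proof.
have [e onbe] := separable_onb sepH.
have [bA _ [t0 ht0]] := HA.
have AS := adjointP sepH bA.
have Ac := hs_sqr_is_trace AS ht0.
set c := complex.Re t0 in Ac.
have [t At] := is_trace_sqr onbe AS Ac.
rewrite (traceE onbe At) (hs_normE onbe AS Ac).
set b := complex.Re `|t|.
have c0 : 0 <= c by apply: le_trans (hs_sum_le (Ac e onbe) 0); rewrite /hs_sum big_geq.
have b0 : 0 <= b by rewrite -ler0c /b RRe_real ?normr_real.
have w2E theta : hs_norm (real_part (expi theta \*: A)) =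
    Num.sqrt ((c + complex.Re (expi theta ^+ 2 * t)) / 2).
  have u1 := sqmod_expi theta.
  apply: (hs_normE onbe (real_part_self_adj AS u1)).
  exact: hs_sqr_real_part onbe AS Ac At u1.
have wle : Num.sqrt ((c + b) / 2) <= w2 A.
  have [theta tE] := phase_exists t.
  (* The supremum dominates its members only if the set is bounded above; the value at the optimal
     phase is itself an upper bound. *)
  apply: ub_le_sup; last by exists theta => //; rewrite w2E tE.
  exists (Num.sqrt ((c + b) / 2)) => _ [phi _ <-]; rewrite w2E ler_sqrt.
    by rewrite ler_pM2r// lerD2l Re_phase_le.
  by rewrite divr_ge0// addr_ge0.
apply: le_trans wle; rewrite ge_max; apply/andP; split.
  (* The first bound is sqrt (c / 2) <= sqrt ((c + b) / 2), as b >= 0. *)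
  rewrite mulrC -sqrtrV// -sqrtrM// ler_sqrt ?ler_pM2r ?lerDl//.
  by rewrite divr_ge0// addr_ge0.
rewrite -[leLHS]ger0_norm; last by rewrite divr_ge0// addr_ge0 ?sqrtr_ge0.
rewrite -sqrtr_sqr ler_sqrt; last by rewrite divr_ge0// addr_ge0.
have := sqr_sqrtr c0; have := sqr_sqrtr b0.
(* With c = x^2 and b = y^2, the second bound reduces to (x - y)^2 >= 0. *)
set x := Num.sqrt c; set y := Num.sqrt b => <- <-.
have := sqr_ge0 (x - y); rewrite expr_div_n; nra.
Qed.
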